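(* Let $d=(d_1,d_2,\dots)$ be a sequence of non-negative integers. For all $k\in\mathbb{N}$ (with $k \ge 1$), the $d$-copycut graph $G_k$ admits a KT orientation.
   Context: All graphs are finite and simple. An orientation $D$ of a graph $G$ is a KT orientation if for all distinct vertices $u,v$ there is at most one directed path (in any direction) between $u$ and $v$ in $D$, i.e. the total number of directed paths from $u$ to $v$ and from $v$ to $u$ is at most one. A graph admits a KT orientation if at least one of its orientations is a KT orientation. Construction of the $d$-copycut graphs $G_1,G_2,\dots$ for a sequence $d=(d_1,d_2,\dots)$ of non-negative integers. The vertex set of each $G_k$ is partitioned into branch vertices and inner vertices; the branch vertices form an independent set. $G_1$ is the one-vertex graph, whose vertex is a branch vertex. For $k\ge 1$, $G_{k+1}$ is obtained from $G_k$ as follows. Let $n_k=|V(G_k)|$, let $b_1,\dots,b_l$ be an enumeration of the branch vertices of $G_k$, and let $x_1,\dots,x_{n_k}$ be an enumeration of $V(G_k)$. (1) Take $d_k$ pairwise disjoint copies $G_k^1,\dots,G_k^{d_k}$ of $G_k$, and for each $r\in\{1,\dots,l\}$ identify the $d_k$ copies of $b_r$ into a single vertex $c_r$. Call the resulting graph $G_k^*$; its branch vertices are $c_1,\dots,c_l$. (If $d_k=0$, $G_k^*$ is the edgeless graph on $c_1,\dots,c_l$.) (2) For each branch vertex $v$ of $G_k^*$, add a new disjoint copy $G_k(v)$ of $G_k$. (3) Replace each branch vertex $v$ of $G_k^*$ by $n_k$ pairwise non-adjacent copies $v_1,\dots,v_{n_k}$, each having the same neighbourhood as $v$ has in $G_k^*$.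 (4) For each branch vertex $v$ of $G_k^*$ and each $i\in\{1,\dots,n_k\}$, add an edge between $v_i$ and the vertex corresponding to $x_i$ in $G_k(v)$. The resulting graph is $G_{k+1}$; its branch vertices are all the vertices $v_i$ ($v$ a branch vertex of $G_k^*$, $1\le i\le n_k$), and all its other vertices are inner vertices. *)

(* Defs.v *)
From HB Require Import structures.
From mathcomp Require Import all_boot.

Set Implicit Arguments.
Unset Strict Implicit.
Unset Printing Implicit Defensive.

Record sgraph := SGraph {
  vertex :> finType;
  adj : rel vertex;
  adj_sym : symmetric adj;
  adj_irr : irreflexive adj }.

Section Orientation.
Variable G : sgraph.

Definition is_orientation (D : rel G) : Prop :=
  forall x y : G, adj x y = D x y || D y x /\ ~~ (D x y && D y x).

(* The vertex sequence s, endpoints included, is a directed path from u to v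
   in D. *)
Definition dipath (D : rel G) (u v : G) (s : seq G) : bool :=
  if s is x :: p then [&& x == u, path D x p, last x p == v & uniq s]
  else false.

(* A path from u to v and a path from v to u differ as vertex sequences when
   u != v, so they count as two paths here. *)
Definition is_KT (D : rel G) : Prop :=
  forall u v : G, u != v -> forall s t : seq G,
    dipath D u v s || dipath D v u s ->
    dipath D u v t || dipath D v u t -> s = t.

Definition admits_KT_orientation : Prop :=
  exists2 D : rel G, is_orientation D & is_KT D.

End Orientation.

Record bgraph := BGraph {
  bgraph_graph :> sgraph;
  branch : pred bgraph_graph;
  branch_indep : forall x y, branch x -> branch y -> ~~ adj x y }.

Notation branch_vertex G := {x : vertex (bgraph_graph G) | branch x}.
Notation inner_vertex G := {x : vertex (bgraph_graph G) | ~~ branch x}.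

Section OneVertex.

Definition one_adj : rel unit := fun _ _ => false.

Fact one_adj_sym : symmetric one_adj. Proof. by []. Qed.
Fact one_adj_irr : irreflexive one_adj. Proof. by []. Qed.

Definition one_graph := SGraph one_adj_sym one_adj_irr.

Fact one_indep (x y : one_graph) : predT x -> predT y -> ~~ adj x y.
Proof. by []. Qed.

Definition one_bgraph := BGraph one_indep.

End OneVertex.

(* d copies of G glued along their branch vertices: inl b is the vertex c_r
   obtained from all the copies of b = b_r, and inr (j, x) is the inner vertex x
   of the j-th copy. No two vertices inl b, inl b' are adjacent since the branch
   vertices of G are independent. *)
Section Glue.
Variables (d : nat) (G : bgraph).

Definition glue_vertex : finType :=
  (branch_vertex G + 'I_d * inner_vertex G)%type.

Definition glue_adj : rel glue_vertex := fun p q =>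
  match p, q with
  | inl _, inl _ => false
  | inl b, inr (_, x) => adj (val b) (val x)
  | inr (_, x), inl b => adj (val x) (val b)
  | inr (i, x), inr (j, y) => (i == j) && adj (val x) (val y)
  end.

Fact glue_adj_sym : symmetric glue_adj.
Proof.
move=> [b|[i x]] [b'|[j y]] //=; rewrite 1?adj_sym //.
by rewrite eq_sym.
Qed.

Fact glue_adj_irr : irreflexive glue_adj.
Proof. by move=> [b|[i x]] //=; rewrite adj_irr andbF. Qed.

Definition glue_graph := SGraph glue_adj_sym glue_adj_irr.

Definition glue_branch : pred glue_graph :=
  fun p : glue_vertex => if p is inl _ then true else false.

Fact glue_indep (x y : glue_graph) :
  glue_branch x -> glue_branch y -> ~~ adj x y.
Proof. by case: x y => [b|[i x]] [b'|[j y]]. Qed.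

Definition glue := BGraph glue_indep.

End Glue.

(* Vertices, for H = G_k^* and G = G_k:
   - Inner x: an inner vertex x of H;
   - Split (v, i): the copy v_i of the branch vertex v of H;
   - Added (v, x): the vertex x of the added copy G(v) of G.
   The vertices of G are enumerated by enum_val : 'I_#|G| -> G. *)
Section Expand.
Variables (H G : bgraph).

Definition expand_vertex : finType :=
  (inner_vertex H + (branch_vertex H * 'I_#|G| + branch_vertex H * G))%type.

Notation Inner x := (inl x).
Notation Split v i := (inr (inl (v, i))).
Notation Added v x := (inr (inr (v, x))).

Definition expand_adj : rel expand_vertex := fun p q =>
  match p, q with
  | Inner x, Inner y => adj (val x) (val y)
  | Inner x, Split v _ => adj (val x) (val v)
  | Split v _, Inner x => adj (val v) (val x)
  | Split v i, Added w x => (v == w) && (x == enum_val i)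
  | Added w x, Split v i => (v == w) && (x == enum_val i)
  | Added v x, Added w y => (v == w) && adj x y
  | Split _ _, Split _ _ => false
  | Inner _, Added _ _ => false
  | Added _ _, Inner _ => false
  end.

Fact expand_adj_sym : symmetric expand_adj.
Proof.
move=> [x|[[v i]|[v x]]] [y|[[w j]|[w y]]] //=; rewrite 1?adj_sym //.
by rewrite eq_sym.
Qed.

Fact expand_adj_irr : irreflexive expand_adj.
Proof. by move=> [x|[[v i]|[v x]]] //=; rewrite adj_irr ?andbF. Qed.

Definition expand_graph := SGraph expand_adj_sym expand_adj_irr.

Definition expand_branch : pred expand_graph :=
  fun p : expand_vertex => if p is Split _ _ then true else false.

Fact expand_indep (x y : expand_graph) :
  expand_branch x -> expand_branch y -> ~~ adj x y.
Proof. by case: x y => [x|[[v i]|[v x]]] [y|[[w j]|[w y]]]. Qed.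

Definition expand := BGraph expand_indep.

End Expand.

Definition copycut_step (d : nat) (G : bgraph) : bgraph := expand (glue d G) G.

(* Indices start at 1: d k is d_k and copycut d k is G_k for k >= 1; d 0 is
   unused and copycut d 0 is a dummy value. *)
Fixpoint copycut (d : nat -> nat) (k : nat) : bgraph :=
  match k with
  | 0 => one_bgraph
  | j.+1 => if j == 0 then one_bgraph else copycut_step (d j) (copycut d j)
  end.

(* Main.v *)
(** Branch vertices can all be made sources. A directed walk then never enters
    a branch vertex after its start, so in G_k^* it stays within a single copy
    of G_k, and in G_{k+1} it stays, after its start, either among the inner
    vertices of G_k^* or in a single added copy of G_k. The edges at the split
    vertices v_i are oriented away from v_i, so the branch vertices are sources
    again. *)
Require Import Defs.
From mathcomp Require Import all_boot.

Set Implicit Arguments.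
Unset Strict Implicit.
Unset Printing Implicit Defensive.

(* Taking [p] empty shows that there is no closed walk: a relation with unique
   walks is acyclic, and its walks are paths. *)
Definition unique_walks (T : Type) (D : rel T) : Prop :=
  forall u p q, path D u p -> path D u q -> last u p = last u q -> p = q.

Lemma unique_walks_KT (G : sgraph) (D : rel G) : unique_walks D -> is_KT D.
Proof.
move=> uniD.
have same u v s t : dipath D u v s -> dipath D u v t -> s = t.
  case: s t => [|x p] [|y q] //= /and4P[/eqP-> Dp /eqP lp _].
  by move=> /and4P[/eqP-> Dq /eqP lq _]; rewrite (uniD u p q) // lp lq.
have opposite u v s t : u != v -> dipath D u v s -> dipath D v u t -> False.
  case: s t => [|x p] [|y q] //= uDv /and4P[/eqP-> Dp /eqP lp _].
  move=> /and4P[/eqP-> Dq /eqP lq _].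
  (* Opposite paths concatenate to a closed walk at [u]; compared with the empty walk it must be
     empty, which forces [u = v]. *)
  have Dpq : path D u (p ++ q) by rewrite cat_path Dp lp.
  have lpq : last u (p ++ q) = last u [::] by rewrite last_cat lp.
  have := uniD u _ [::] Dpq isT lpq.
  by case: p lp {Dp Dpq lpq} => //= uv; rewrite uv eqxx in uDv.
move=> u v uDv s t /orP[us|vs] /orP[ut|vt].
- exact: same us ut.
- by case: (opposite _ _ _ _ uDv us vt).
- by case: (opposite _ _ _ _ uDv ut vs).
- exact: same vs vt.
Qed.

Section WalkTransfer.
Variables (S T T' : Type) (D : rel T) (D' : rel T') (f : S -> T) (g : S -> T').
Hypothesis succ_f : forall s y, D (f s) y ->
  exists2 s', y = f s' & D' (g s) (g s').

(** The image of [f] is closed under successors, so a walk starting there lifts step by step to [S].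
    The third type [S] serves inner vertices: [f] places them in the large graph, and [g] is their
    inclusion [val] in the small one. *)
Lemma path_transfer s p :
  path D (f s) p -> exists2 q, p = map f q & path D' (g s) (map g q).
Proof.
elim: p s => [|y p IHp] s /=; first by exists [::].
case/andP=> /succ_f[s' -> Dss'] /IHp[q -> Dq].
by exists (s' :: q) => //=; rewrite Dss'.
Qed.

Lemma unique_walks_transfer s p q :
    injective f -> injective g -> unique_walks D' ->
  path D (f s) p -> path D (f s) q -> last (f s) p = last (f s) q -> p = q.
Proof.
move=> injf injg uniD' /path_transfer[p' -> Dp] /path_transfer[q' -> Dq].
rewrite !last_map => /injf eq_last; congr map.
by apply: (inj_map injg); apply: uniD' Dp Dq _; rewrite !last_map eq_last.
Qed.

End WalkTransfer.

Definition source_branches (G : bgraph) (D : rel G) : Prop :=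
  forall x y, branch y -> D x y = false.

Definition source_KT (G : bgraph) : Prop :=
  exists D : rel G, [/\ is_orientation D, unique_walks D & source_branches D].

(** The last step of a nonempty walk would enter the source [u]. *)
Lemma source_walk (G : bgraph) (D : rel G) (u x : G) p :
  source_branches D -> branch u -> path D x p -> last x p = u -> p = [::].
Proof.
move=> srcD bu; case/lastP: p => // p y; rewrite rcons_path last_rcons.
by move=> /andP[_ Dy] yu; rewrite yu srcD in Dy.
Qed.

(** No nonempty walk returns to [u], so only two nonempty walks remain to be compared. *)
Lemma unique_walks_source (G : bgraph) (D : rel G) (u : G) :
    source_branches D -> branch u ->
    (forall y z p q, D u y -> D u z -> path D y p -> path D z q ->
      last y p = last z q -> y :: p = z :: q) ->
  forall p q, path D u p -> path D u q -> last u p = last u q -> p = q.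
Proof.
move=> srcD bu uni_succ [|y p] [|z q] //.
- by move=> _ Dq /esym lq; rewrite (source_walk srcD bu Dq lq).
- by move=> Dp _ lp; rewrite (source_walk srcD bu Dp lp).
by move=> /= /andP[Dy Dp] /andP[Dz Dq]; apply: uni_succ.
Qed.

Section GlueOrientation.
Variables (d : nat) (G : bgraph) (D : rel G).
Hypotheses (oriD : is_orientation D) (uniD : unique_walks D).
Hypothesis srcD : source_branches D.

(** Each copy inherits [D]. The wildcard case loses no arc, as [D] has none into a branch vertex. *)
Definition glue_dir : rel (glue d G) := fun p q : glue_vertex d G =>
  match p, q with
  | inl b, inr (_, x) => D (val b) (val x)
  | inr (i, x), inr (j, y) => (i == j) && D (val x) (val y)
  | _, _ => false
  end.

Lemma glue_dir_orientation : is_orientation glue_dir.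
Proof.
have adjD x y := (oriD x y).1; have asymD x y := (oriD x y).2.
move=> [b|[i x]] [c|[j y]] //=; rewrite ?adjD ?andbF ?orbF //=.
- by rewrite (srcD _ (valP b)) orbF.
- by rewrite (srcD _ (valP c)).
by rewrite eq_sym; case: eqP => //= _; split.
Qed.

Lemma glue_dir_source : source_branches glue_dir.
Proof. by move=> [b|[i x]] [c|[j y]]. Qed.

Lemma glue_dir_copy i x y : glue_dir (inr (i, x)) y ->
  exists2 x', y = inr (i, x') & D (val x) (val x').
Proof. by case: y => [//|[j y]] /= /andP[/eqP <- Dxy]; exists y. Qed.

Lemma glue_dir_unique : unique_walks glue_dir.
Proof.
have copyP i := path_transfer (@glue_dir_copy i).
move=> [b|[i x]]; last first.
  move=> p q; apply: (unique_walks_transfer (@glue_dir_copy i) _ val_inj uniD).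
  by move=> ? ? [].
apply: unique_walks_source glue_dir_source _ _ => //.
move=> [//|[i x]] [//|[j y]] p q /= Dx Dy /copyP[p' -> Dp] /copyP[q' -> Dq].
rewrite (last_map (fun z => inr (i, z))) (last_map (fun z => inr (j, z))).
(* The common endpoint forces [i = j]. The first inner vertices may still differ, so uniqueness in
   [D] is applied to the whole walks from [val b]. *)
case=> <- eq_last; rewrite -!(map_cons (fun z => inr (i, z))); congr map.
apply: (inj_map val_inj); apply: (uniD (u := val b)); rewrite /= ?Dx ?Dy //.
by rewrite !last_map eq_last.
Qed.

End GlueOrientation.

Lemma glue_source_KT d (G : bgraph) : source_KT G -> source_KT (glue d G).
Proof.
case=> D [oriD uniD srcD]; exists (glue_dir (d := d) D); split.
- exact: glue_dir_orientation.
- exact: glue_dir_unique.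
- exact: glue_dir_source.
Qed.

Section ExpandOrientation.
Variables (H G : bgraph) (DH : rel H) (D : rel G).
Hypotheses (oriH : is_orientation DH) (uniH : unique_walks DH).
Hypothesis srcH : source_branches DH.
Hypotheses (oriD : is_orientation D) (uniD : unique_walks D).

Definition expand_dir : rel (expand H G) := fun p q : expand_vertex H G =>
  match p, q with
  | inl x, inl y => DH (val x) (val y)
  | inr (inl (v, _)), inl y => DH (val v) (val y)
  | inr (inl (v, i)), inr (inr (w, x)) => (v == w) && (x == enum_val i)
  | inr (inr (v, x)), inr (inr (w, y)) => (v == w) && D x y
  | _, _ => false
  end.

Lemma expand_dir_orientation : is_orientation expand_dir.
Proof.
have adjH x y := (oriH x y).1; have asymH x y := (oriH x y).2.
have adjD x y := (oriD x y).1; have asymD x y := (oriD x y).2.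
move=> [x|[[v i]|[v x]]] [y|[[w j]|[w y]]] //=;
  rewrite ?adjH ?adjD ?andbF ?orbF //=.
- by rewrite (srcH _ (valP w)).
- by rewrite (srcH _ (valP v)) orbF.
by rewrite eq_sym; case: eqP => //= _; split.
Qed.

Lemma expand_dir_source : source_branches expand_dir.
Proof. by move=> [x|[[v i]|[v x]]] [y|[[w j]|[w y]]]. Qed.

Lemma expand_dir_inner x y : expand_dir (inl x) y ->
  exists2 x', y = inl x' & DH (val x) (val x').
Proof. by case: y => [y|[[w j]|[w y]]] //= Dxy; exists y. Qed.

Lemma expand_dir_added v x y : expand_dir (inr (inr (v, x))) y ->
  exists2 x', y = inr (inr (v, x')) & D x x'.
Proof.
by case: y => [y|[[w j]|[w y]]] //= /andP[/eqP <- Dxy]; exists y.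
Qed.

(** The inner vertices and each added copy are closed under successors, so walks there reduce to
    [DH] and [D]; for a walk from a split vertex, the first step selects one of these regions. *)
Lemma expand_dir_unique : unique_walks expand_dir.
Proof.
have innerP := path_transfer expand_dir_inner.
have addedP v := path_transfer (g := id) (@expand_dir_added v).
have uni_added v x p q : path expand_dir (inr (inr (v, x))) p ->
    path expand_dir (inr (inr (v, x))) q ->
    last (inr (inr (v, x))) p = last (inr (inr (v, x))) q -> p = q.
  apply: (unique_walks_transfer (g := id) (@expand_dir_added v)) => //.
  by move=> ? ? [].
move=> [x|[[v i]|[v x]]]; last by move=> p q; apply: uni_added.
  move=> p q; apply: (unique_walks_transfer expand_dir_inner _ val_inj uniH).
  by move=> ? ? [].
apply: unique_walks_source expand_dir_source _ _ => //.
move=> [x|[[//]|[w x]]] [y|[[//]|[w' y]]] p q //=.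
- move=> Dx Dy /innerP[p' -> Dp] /innerP[q' -> Dq].
  rewrite !(last_map inl) => -[eq_last]; rewrite -!(map_cons inl); congr map.
  apply: (inj_map val_inj); apply: (uniH (u := val v)); rewrite /= ?Dx ?Dy //.
  by rewrite !last_map eq_last.
(* In the two mixed cases the endpoints lie in disjoint regions. *)
- move=> _ _ /innerP[p' -> _] /addedP[q' -> _].
  by rewrite (last_map inl) (last_map (fun z => inr (inr (w', z)))).
- move=> _ _ /addedP[p' -> _] /innerP[q' -> _].
  by rewrite (last_map inl) (last_map (fun z => inr (inr (w, z)))).
(* A split vertex has a single neighbour in its added copy, so both walks enter that copy at
   [enum_val i]. *)
move=> /andP[/eqP <- /eqP->] /andP[/eqP <- /eqP->] Dp Dq eq_last.
by congr cons; apply: uni_added Dp Dq eq_last.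
Qed.

End ExpandOrientation.

Lemma expand_source_KT (H G : bgraph) :
  source_KT H -> source_KT G -> source_KT (expand H G).
Proof.
case=> DH [oriH uniH srcH] [D [oriD uniD _]]; exists (expand_dir DH D); split.
- exact: expand_dir_orientation.
- exact: expand_dir_unique.
- exact: expand_dir_source.
Qed.

Lemma one_source_KT : source_KT one_bgraph.
Proof. by exists (fun _ _ => false); split=> // -u [|x p] [|y q]. Qed.

Lemma copycut_source_KT d k : source_KT (copycut d k).
Proof.
elim: k => [|k IHk] /=; first exact: one_source_KT.
(* Index 1 is again the one-vertex graph; the construction step starts at index 2. *)
case: eqP => _; first exact: one_source_KT.
exact: expand_source_KT (glue_source_KT _ IHk) IHk.
Qed.

Theorem theorem3p2 (d : nat -> nat) (k : nat) (hk : 1 <= k) :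
  admits_KT_orientation (copycut d k).
Proof.
have [D [oriD uniD _]] := copycut_source_KT d k.
by exists D => //; apply: unique_walks_KT.
Qed.
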